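(* There exists a function $f:\mathbb{Z}_{\geq 1}^3\to\mathbb{Z}_{\geq 1}$ such that the following holds. Let $k,n,r$ be positive integers and let $G$ be a group generated by $r$ elements $a_1,\dots,a_r$ such that $|a_i|_k\leq n$ for every $i=1,\dots,r$. Then $\gamma_{k+1}(G)$ is finite and $|\gamma_{k+1}(G)|\leq f(k,n,r)$.
   Context: For elements of a group, $[x,y]=x^{-1}y^{-1}xy$, and $[x_1,\dots,x_k]=[\dots[[x_1,x_2],x_3]\dots,x_k]$ denotes the left-normed commutator. For a group $G$, an element $a\in G$ and an integer $k\geq 1$, $|a|_k$ denotes the cardinality of the set $\{[a,x_1,\dots,x_k] : x_1,\dots,x_k\in G\}$. $\gamma_i(G)$ denotes the $i$th term of the lower central series of $G$ (with $\gamma_1(G)=G$). *)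

(* Defs.v *)
From mathcomp Require Import all_boot.
From mathcomp Require Import all_classical.

Set Implicit Arguments.
Unset Strict Implicit.
Unset Printing Implicit Defensive.

Local Open Scope classical_set_scope.
Local Open Scope group_scope.

(* [group_closed] is a predicate on [{pred G}]; [mem] casts a classical set. *)
Definition subgroups (G : groupType) : set (set G) :=
  [set H | group_closed (mem H)].
Arguments subgroups G : clear implicits.

Definition generated (G : groupType) (A : set G) : set G :=
  smallest (subgroups G) A.

Definition comm_subgroup (G : groupType) (A B : set G) : set G :=
  generated [set [~ x, y] | x in A & y in B].

(* Indexed from 1, as ['L_i(G)] for finite groups; the index 0 gives G too. *)
Definition lower_central (G : groupType) (i : nat) : set G :=
  iter i.-1 (fun H => comm_subgroup H [set: G]) [set: G].
Arguments lower_central G i : clear implicits.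

Definition lncomm (G : groupType) (a : G) (s : seq G) : G := foldl commg a s.

(* The set of all [a, x_1, ..., x_k], whose cardinality is |a|_k. *)
Definition lncomm_set (G : groupType) (k : nat) (a : G) : set G :=
  range (fun x : k.-tuple G => lncomm a x).

(* Main.v *)
Require Import Defs.
From mathcomp Require Import all_boot.
From mathcomp Require Import all_classical.

Set Implicit Arguments.
Unset Strict Implicit.
Unset Printing Implicit Defensive.

Local Open Scope classical_set_scope.
Local Open Scope card_scope.

(** Let [X] be the union of the [r] sets of commutators [[a_i, x_1, ..., x_k]];
    it has at most [r * n] elements.  From
    [[y, x]^z = [y, z]^-1 [y, x z]] the set [Y] of all conjugates of elements
    of [X] lies in [X^-1 X], so it has at most [s = (r n)^2] elements, and it
    is closed under inversion.  Modulo the normal subgroup [N] generated by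
    [Y], every generator [a_i] lies in the [k]-th term of the upper central
    series; hence [N] contains the [k.+1]-th lower central term, and it is
    enough to bound the order of [N].

    The engine is the collection argument of Dietzmann and Schur
    ([products_short]): if, modulo a normal subgroup [M], the [e]-th power of
    each [u] in [Y] is a product of fewer than [e] elements of [Y], then every
    product of elements of [Y] is a product of boundedly many, because in a
    long product some letter occurs [e] times, these occurrences can be
    gathered in front, and their product rewritten as a shorter word.

    It is used first, modulo 1, for the subgroup [M] generated by the
    elements of [Y] whose [n`!]-th power is 1, and then for [N] modulo [M].
    The second use needs the shortening rule.  For [c = [y, x]] in [X], the
    product [c c^x = [y, x x]] is again in [X], so
    [c^(E+1) = c (c^E) = (c c^x) (c^x)^(E-1)] modulo [M] as soon as [c^E]
    commutes with [x] modulo [M].  It remains to find [E] such that [c^E] is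
    central modulo [M].

    Let [A] be the centre of [N], an abelian normal subgroup of the whole
    group.  All [m]-th powers, [m = s`!], centralise [Y], since conjugation
    permutes [Y]; in particular [c^m] is in [A].
    - [A] lies in the [k]-th upper central term modulo [M]: on [A] the map
      [d |-> [a_i, d, z_1, ..., z_(k-1)]] is a homomorphism into [A], and its
      values lie in a set of at most [n] elements, so they are killed by [n`!]
      and belong to [M]; as the [a_i] generate the group, this passes from
      [[a_i, d]] to all [[x, d]].
    - Raising to the power [m] moves an element of [A] one step down in the
      upper central series modulo [M] ([ucs_expg]), since for [v] in [A]
      and in the [(l + 2)]-nd term, [[v, z]^m = [v, z^m] = 1] modulo the
      [l]-th one.

    So [E = m^k] works. *)

(** * Normal subgroups and commutator identities *)

Record normal_subgroup {G : groupType} (H : set G) : Prop := NormalSubgroup {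
  normal1 : H 1%g;
  normalM : forall u v, H u -> H v -> H (u * v)%g;
  normalV : forall u, H u -> H u^-1%g;
  normalJ : forall u g, H u -> H (u ^ g)%g }.

Lemma group_closed_mem {G : groupType} {H : set G} :
  normal_subgroup H -> group_closed (mem H).
Proof.
move=> nH; split; first by apply/mem_set/(normal1 nH).
move=> u v /set_mem Hu /set_mem Hv.
by apply/mem_set/(normalM nH)/(normalV nH).
Qed.

Lemma trivial_normal {G : groupType} : normal_subgroup [set 1%g : G].
Proof.
split=> //= [_ _ -> ->|_ ->|_ g ->]; [exact: mulg1|exact: invg1|].
exact: conj1g.
Qed.

Lemma generated_ind {G : groupType} {A : set G} (P : set G) :
    generated A = [set: G] -> P 1%g ->
    (forall u v, P u -> P v -> P (u * v)%g) ->
    (forall u, P u -> P u^-1%g) -> A `<=` P ->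
  forall x, P x.
Proof.
move=> genA P1 PM PV AP x.
suff: generated A x by apply: smallest_sub AP x; split;
  [apply/mem_set | move=> u v /set_mem Pu /set_mem Pv; apply/mem_set/PM/PV].
by rewrite genA.
Qed.

Lemma commMg {G : groupType} (x y z : G) :
  ([~ x * y, z] = [~ x, z] ^ y * [~ y, z])%g.
Proof. by rewrite !commgEl !conjgE !invgM !mulgA !(mulgK, mulgVK). Qed.

Lemma commgM {G : groupType} (x y z : G) :
  ([~ x, y * z] = [~ x, z] * [~ x, y] ^ z)%g.
Proof. by rewrite !commgEl !conjgE !invgM !mulgA !(mulgK, mulgVK). Qed.

Lemma commVg {G : groupType} (x z : G) :
  ([~ x^-1, z] = ([~ x, z]^-1) ^ x^-1)%g.
Proof. by rewrite !commgEl !conjgE !invgM !invgK !mulgA !(mulgK, mulgVK). Qed.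

Lemma commgV {G : groupType} (x z : G) :
  ([~ x, z^-1] = ([~ x, z]^-1) ^ z^-1)%g.
Proof.
by rewrite !commgEl !conjgE !invgM !invgK !mulgA
  !(mulgK, mulgVK, mulgV, mul1g).
Qed.

(** * Exponents from finite sets *)

(** The pigeonhole period depends on [f]; only the fact that it divides [n`!]
    gives one exponent that serves for all functions at once. *)
Lemma factorial_recurrence (T : eqType) (f : nat -> T) (S : seq T) n :
    size S <= n -> (forall j, f j \in S) ->
  exists i q, q %| n`! /\ f (q + i) = f i.
Proof.
move=> leSn fS.
have /(uniqPn (f 0)) [i [j [ltij]]] : ~~ uniq [seq f i | i <- iota 0 n.+1].
  apply/negP=> /uniq_leq_size leS.
  have: size [seq f i | i <- iota 0 n.+1] <= size S.
    by apply: leS => _ /mapP[j _ ->].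
  by rewrite size_map size_iota ltnNge leSn.
rewrite size_map size_iota => ltjn.
have ltin := ltn_trans ltij ltjn.
rewrite !(nth_map 0) ?size_iota // !nth_iota // !add0n => fij.
exists i, (j - i); rewrite subnK 1?ltnW // fij; split=> //.
by rewrite dvdn_fact // subn_gt0 ltij (leq_trans (leq_subr _ _)).
Qed.

Lemma expg_fact {G : groupType} (g : G) (S : seq G) n :
    size S <= n -> (forall j, (g ^+ j)%g \in S) ->
  (g ^+ n`! = 1)%g.
Proof.
move=> leSn gS.
have [i [q [/dvdnP[p ->]]]] := factorial_recurrence leSn gS.
rewrite expgnDr => /eqP; rewrite -{2}[(g ^+ i)%g]mul1g (inj_eq (mulIg _)).
by move=> /eqP gq; rewrite mulnC expgnA gq expg1n.
Qed.

Definition conj_stable {G : groupType} (Y : seq G) :=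
  forall u g, u \in Y -> (u ^ g)%g \in Y.

(** Conjugation by [x] permutes the finite set [Y], so every orbit of [x] has
    length at most [n]. *)
Lemma commute_expg_fact {G : groupType} (Y : seq G) (u x : G) n :
  conj_stable Y -> size Y <= n -> u \in Y -> commute u (x ^+ n`!)%g.
Proof.
move=> JY leYn Yu.
have [|i [q [/dvdnP[p ->]]]] :=
  factorial_recurrence (f := fun j => (u ^ (x ^+ j))%g) leYn.
  by move=> j; apply: JY.
rewrite expgnDr conjgM => /conjg_inj/conjg_fixP/commgP cuq.
by rewrite mulnC expgnA; apply: commuteX.
Qed.

(** * Products of elements of a finite normal set *)

(** Only positive words are used: when [Y] is closed under inversion and
    conjugation this is the normal subgroup generated by [Y]. *)
Definition products {G : groupType} (Y : seq G) : set G :=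
  [set x | exists2 w : seq G, {subset w <= Y} & x = (\prod_(u <- w) u)%g].

Lemma products_mem {G : groupType} (Y : seq G) u : u \in Y -> products Y u.
Proof.
by move=> Yu; exists [:: u]; rewrite ?big_seq1 // => v /[1!inE] /eqP->.
Qed.

Lemma products_normal {G : groupType} (Y : seq G) :
    conj_stable Y -> (forall u, u \in Y -> u^-1%g \in Y) ->
  normal_subgroup (products Y).
Proof.
move=> JY VY.
have PM u v : products Y u -> products Y v -> products Y (u * v)%g.
  move=> [w Yw ->] [w' Yw' ->]; exists (w ++ w'); last by rewrite big_cat.
  by move=> z; rewrite mem_cat => /orP[/Yw|/Yw'].
have P1 : products Y 1%g by exists [::]; rewrite ?big_nil.
split=> // [_ [w Yw ->] | _ g [w Yw ->]].
  elim: w Yw => [|u w IHw] Yw; first by rewrite big_nil invg1.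
  rewrite big_cons invgM; apply: PM.
    by apply: IHw => v wv; apply: Yw; rewrite inE wv orbT.
  by apply/products_mem/VY/Yw; rewrite mem_head.
exists [seq u ^ g | u <- w]%g; last by rewrite big_map conjg_prod.
by move=> _ /mapP[u /Yw Yu ->]; apply: JY.
Qed.

Lemma products_commute {G : groupType} (Y : seq G) (x z : G) :
  products Y x -> (forall u, u \in Y -> commute z u) -> commute z x.
Proof.
move=> [w Yw ->] cz; elim: w Yw => [|u w IHw] Yw.
  by rewrite big_nil; apply: commute1.
rewrite big_cons; apply: commuteM; first by apply/cz/Yw; rewrite mem_head.
by apply: IHw => v wv; apply: Yw; rewrite inE wv orbT.
Qed.

Lemma prod_nseq {G : groupType} (c : G) j :
  (\prod_(v <- nseq j c) v = c ^+ j)%g.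
Proof. by elim: j => [|j IHj]; rewrite ?big_nil // big_cons IHj expgS. Qed.

(** Moving an occurrence of [u] to the front conjugates by [u] the letters that
    it passes.  The new letters stay in [Y], and no occurrence of [u] is gained
    or lost, because [u] is the only element whose conjugate by [u] is [u]. *)
Lemma collect {G : groupType} (Y w : seq G) u j :
    conj_stable Y -> {subset w <= Y} -> j <= count_mem u w ->
  exists w', [/\ {subset w' <= Y}, size w = j + size w' &
    (\prod_(v <- w) v = u ^+ j * \prod_(v <- w') v)%g].
Proof.
move=> JY; elim: j w => [|j IHj] w Yw leju; first by exists w; rewrite mul1g.
have : u \in w by rewrite -has_pred1 has_count (leq_trans _ leju).
move=> wu; case/splitPr: wu Yw leju => p q Yw.
rewrite count_cat /= eqxx addnCA add1n ltnS => leju.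
have [||w' [Yw' sz_w' w'E]] := IHj ([seq v ^ u | v <- p]%g ++ q).
- move=> v; rewrite mem_cat => /orP[/mapP[v' pv' ->]|qv].
    by apply/JY/Yw; rewrite mem_cat pv'.
  by apply: Yw; rewrite mem_cat inE qv !orbT.
- rewrite count_cat count_map (eq_count (a2 := pred1 u)) // => v /=.
  by rewrite (can2_eq (conjgK _) (conjgKV _)) conjgE invgK mulgV mulg1.
exists w'; split=> //.
  by rewrite size_cat /= addnS -size_cat addSn -sz_w' !size_cat size_map.
by rewrite expgS -mulgA -w'E !big_cat big_cons /= big_map -conjg_prod
  -!mulgA mulVKg mulgA.
Qed.

Lemma size_le_count (T : eqType) (Y w : seq T) c :
    {subset w <= Y} -> (forall u, u \in Y -> count_mem u w <= c) ->
  size w <= size Y * c.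
Proof.
elim: Y w => [|y Y IHY] w Yw le_c.
  by case: w Yw {le_c} => // u w /(_ u (mem_head _ _)).
rewrite -(count_predC (pred1 y)) mulSn leq_add ?le_c ?mem_head //.
rewrite -size_filter IHY // => [u | u Yu].
  by rewrite mem_filter /= => /andP[neq /Yw]; rewrite inE (negPf neq).
rewrite count_filter (leq_trans _ (le_c u _)) ?inE ?Yu ?orbT //.
by apply: sub_count => v /andP[].
Qed.

(** A word of length more than [size Y * e.-1] contains some [u] at least [e]
    times; collecting [e] of these and replacing [u ^+ e] by the shorter word
    decreases the length, and the error in [M] is pushed to the right by
    normality. *)
Lemma products_short {G : groupType} (Y : seq G) (M : set G) e :
    conj_stable Y -> normal_subgroup M ->
    (forall u, u \in Y -> exists w t,
       [/\ {subset w <= Y}, size w < e, M t &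
           (u ^+ e = (\prod_(v <- w) v) * t)%g]) ->
  forall x, products Y x -> exists w t,
    [/\ {subset w <= Y}, size w <= size Y * e.-1, M t &
        (x = (\prod_(v <- w) v) * t)%g].
Proof.
move=> JY nM shortY x [w Yw ->{x}].
have [n] := ubnP (size w); elim: n w Yw => // n IHn w Yw; rewrite ltnS => lewn.
have [lew|gtw] := leqP (size w) (size Y * e.-1).
  by exists w, 1%g; split=> //; [exact: normal1 | rewrite mulg1].
have [u Yu gtu] : exists2 u, u \in Y & e.-1 < count_mem u w.
  apply/not_exists2P => H; move: gtw; rewrite ltnNge size_le_count // => u Yu.
  by rewrite leqNgt; apply/negP; have [] := H u.
have leu : e <= count_mem u w by apply: leq_trans (leqSpred e) gtu.
have [w' [Yw' szw ->]] := collect JY Yw leu.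
have [w0 [t [Yw0 szw0 Mt ->]]] := shortY u Yu.
have [||w1 [t1 [Yw1 szw1 Mt1 w1E]]] := IHn (w0 ++ w').
- by move=> v; rewrite mem_cat => /orP[/Yw0|/Yw'].
- by rewrite (leq_trans _ lewn) // szw size_cat ltn_add2r.
set p := (\prod_(v <- w') v)%g in w1E *.
exists w1, (t1 * t ^ p)%g; split=> //.
  by apply: (normalM nM) => //; apply: (normalJ nM).
by rewrite mulgA -w1E big_cat /= -/p -!mulgA; congr (_ * _)%g; rewrite -conjgC.
Qed.

(** Prefixing 1 as a spare letter makes words of length at most [l] into words
    of length exactly [l], whence the simple count below. *)
Fixpoint words_upto {G : groupType} (Y : seq G) (l : nat) : seq G :=
  if l is l'.+1 then [seq u * v | u <- 1 :: Y, v <- words_upto Y l']%g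
  else [:: 1%g].

Lemma size_words_upto {G : groupType} (Y : seq G) l :
  size (words_upto Y l) = (size Y).+1 ^ l.
Proof.
by elim: l => //= l IHl; rewrite size_cat size_map size_allpairs IHl expnS.
Qed.

Lemma mem_words_upto {G : groupType} (Y w : seq G) l :
  {subset w <= Y} -> size w <= l -> (\prod_(v <- w) v)%g \in words_upto Y l.
Proof.
elim: l w => [|l IHl] [|u w] Yw //= szw; rewrite ?big_nil ?big_cons ?inE //.
  rewrite mem_cat; apply/orP; left; apply/mapP; exists 1%g.
    by have := IHl [::] Yw isT; rewrite big_nil.
  by rewrite mulg1.
rewrite mem_cat; apply/orP; right; apply: allpairs_f.
  by apply: Yw; rewrite mem_head.
by apply: IHl => // v wv; apply: Yw; rewrite inE wv orbT.
Qed.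

Definition at_most {G : groupType} (H : set G) (b : nat) :=
  exists2 s : seq G, size s <= b & H `<=` [set` s].

Lemma products_at_most {G : groupType} (Y : seq G) (M : set G) s e b :
    conj_stable Y -> size Y <= s -> normal_subgroup M -> at_most M b ->
    (forall u, u \in Y -> exists w t,
       [/\ {subset w <= Y}, size w < e, M t &
           (u ^+ e = (\prod_(v <- w) v) * t)%g]) ->
  at_most (products Y) (s.+1 ^ (s * e.-1) * b).
Proof.
move=> JY leYs nM [sM leMb sMM] shortY.
exists [seq u * v | u <- words_upto Y (s * e.-1), v <- sM]%g.
  rewrite size_allpairs size_words_upto leq_mul //.
  by case: (s * _) => // l; rewrite leq_exp2r.
move=> x /(products_short JY nM shortY)[w [t [Yw szw Mt ->]]].
apply: allpairs_f; last exact: sMM.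
by apply: mem_words_upto => //; rewrite (leq_trans szw) ?leq_mul2r ?leYs ?orbT.
Qed.

(** Dietzmann's lemma: here the [m]-th power of a letter is the empty word. *)
Lemma torsion_products_at_most {G : groupType} (Y : seq G) s m :
    conj_stable Y -> size Y <= s -> 0 < m ->
    (forall u, u \in Y -> u ^+ m = 1)%g ->
  at_most (products Y) (s.+1 ^ (s * m.-1)).
Proof.
move=> JY leYs m_gt0 Ym; rewrite -[X in at_most _ X]muln1.
apply: (products_at_most JY leYs trivial_normal) => [|u Yu].
  by exists [:: 1%g] => // _ ->; rewrite /= mem_head.
by exists [::], 1%g; split; rewrite ?Ym ?big_nil ?mulg1.
Qed.

(** * The upper central series modulo a normal subgroup *)

(** The preimage in [G] of the [l]-th upper central term of [G / M]; working
    with it avoids forming quotient groups. *)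
Fixpoint ucs {G : groupType} (M : set G) (l : nat) : set G :=
  if l is l'.+1 then [set u | forall z, ucs M l' [~ u, z]%g] else M.

Lemma ucs_normal {G : groupType} (M : set G) l :
  normal_subgroup M -> normal_subgroup (ucs M l).
Proof.
move=> nM; elim: l => //= l nZ; split=> /= [z|u v Zu Zv z|u Zu z|u g Zu z].
- by rewrite comm1g; apply: (normal1 nZ).
- by rewrite commMg; apply: (normalM nZ) => //; apply: (normalJ nZ).
- by rewrite commVg; apply/(normalJ nZ)/(normalV nZ).
- by rewrite -[z](conjgKV g) -conjRg; apply: (normalJ nZ).
Qed.

Lemma ucs_lncomm {G : groupType} (M : set G) l u :
  (forall s : seq G, size s = l -> M (lncomm u s)) -> ucs M l u.
Proof.
elim: l u => [|l IHl] u Mu; first exact: (Mu [::]).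
by move=> z; apply: IHl => s szs; apply: (Mu (z :: s)); rewrite /= szs.
Qed.

(** Modulo the [l]-th term, the elements commuting with [d] form a subgroup;
    if it contains the generators, [d] is central there. *)
Lemma ucs_centralised_by_generators {G : groupType} (A M : set G) l d :
    generated A = [set: G] -> normal_subgroup M ->
    (forall x, A x -> ucs M l [~ x, d]%g) ->
  ucs M l.+1 d.
Proof.
move=> genA /(ucs_normal l) nZ ZA z; rewrite -invgR; apply: (normalV nZ).
move: z; apply: (generated_ind genA) => //.
- by rewrite comm1g; apply: (normal1 nZ).
- move=> x y Zx Zy; rewrite commMg.
  by apply: (normalM nZ) => //; apply: (normalJ nZ).
- by move=> x Zx; rewrite commVg; apply/(normalJ nZ)/(normalV nZ).
Qed.

(** Each commutation with [G] takes both series one term down, so the lower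
    series stays below the upper one, started from its top. *)
Lemma lower_central_ucs {G : groupType} (N : set G) k :
    normal_subgroup N -> (forall x, ucs N k x) ->
  lower_central G k.+1 `<=` N.
Proof.
move=> nN Zk; suff H i : i <= k -> lower_central G i.+1 `<=` ucs N (k - i).
  by have := H k (leqnn k); rewrite subnn.
elim: i => [_ x _|i IHi ltik]; first by rewrite subn0.
rewrite /lower_central /=; apply: smallest_sub.
  exact/group_closed_mem/ucs_normal.
move=> _ [x /(IHi (ltnW ltik))] /[swap] -[y _ <-].
by rewrite -(subnSK ltik); apply.
Qed.

(** * The sets of values of long commutators *)

Lemma lncomm_setP {G : groupType} k (a u : G) :
  lncomm_set k a u <-> exists2 s : seq G, size s = k & u = lncomm a s.
Proof.
split=> [[t _ <-]|[s /eqP szs ->]]; first by exists t; rewrite ?size_tuple.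
by exists (Tuple szs).
Qed.

Lemma lncomm_setSP {G : groupType} k (a u : G) :
  lncomm_set k.+1 a u <->
  exists (s : seq G) x, size s = k /\ u = [~ lncomm a s, x]%g.
Proof.
rewrite lncomm_setP; split=> [[s + ->]|[s [x [szs ->]]]].
  case/lastP: s => // s x; rewrite size_rcons => -[szs]; exists s, x.
  by rewrite /lncomm foldl_rcons.
by exists (rcons s x); rewrite ?size_rcons ?szs // /lncomm foldl_rcons.
Qed.

(** Solving [[y, x z] = [y, z] [y, x]^z] for the conjugate shows that a finite
    set of values has finitely many conjugates. *)
Lemma lncomm_set_conj {G : groupType} k (a u z : G) :
    lncomm_set k.+1 a u ->
  exists v w,
    [/\ lncomm_set k.+1 a v, lncomm_set k.+1 a w & u ^ z = v^-1 * w]%g.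
Proof.
case/lncomm_setSP => s [x [szs ->]]; set y := lncomm a s.
exists [~ y, z]%g, [~ y, x * z]%g; split; last by rewrite commgM mulKg.
  by apply/lncomm_setSP; exists s, z.
by apply/lncomm_setSP; exists s, (x * z)%g.
Qed.

Lemma lncomm_set_inv {G : groupType} k (a u : G) :
    lncomm_set k.+1 a u ->
  exists v x, lncomm_set k.+1 a v /\ (u^-1 = v ^ x)%g.
Proof.
case/lncomm_setSP => s [x [szs ->]]; exists [~ lncomm a s, x^-1]%g, x.
split; first by apply/lncomm_setSP; exists s, x^-1%g.
by rewrite commgV -conjgM mulVg conjg1.
Qed.

(** The identity [[y, x x] = [y, x] [y, x]^x] makes two letters into one; the
    shortening of high powers of [u] rests on it. *)
Lemma lncomm_set_mulJ {G : groupType} k (a u : G) :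
    lncomm_set k.+1 a u -> exists x, lncomm_set k.+1 a (u * u ^ x)%g.
Proof.
case/lncomm_setSP => s [x [szs ->]]; exists x; rewrite -commgM.
by apply/lncomm_setSP; exists s, (x * x)%g.
Qed.

(** * Commutators with elements of an abelian normal subgroup *)

Definition abelian_set {G : groupType} (A : set G) :=
  forall u v, A u -> A v -> commute u v.

Lemma normal_commg {G : groupType} (A : set G) d z :
  normal_subgroup A -> A d -> A [~ d, z]%g.
Proof.
by move=> nA Ad; rewrite commgEl; apply/(normalM nA)/(normalJ nA) => //;
  apply: (normalV nA).
Qed.

Lemma normalX {G : groupType} (A : set G) d j :
  normal_subgroup A -> A d -> A (d ^+ j)%g.
Proof.
move=> nA Ad; elim: j => [|j IHj]; first exact: normal1.
by rewrite expgS; apply: (normalM nA).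
Qed.

(** [[d, z]] lies again in [A], so it commutes with the powers of [d], and the
    twist in the identity [commMg] disappears. *)
Lemma commXg_abelian {G : groupType} (A : set G) d z j :
    normal_subgroup A -> abelian_set A -> A d ->
  ([~ d ^+ j, z] = [~ d, z] ^+ j)%g.
Proof.
move=> nA cA Ad; elim: j => [|j IHj]; first by rewrite comm1g.
rewrite expgS commMg IHj expgS; congr (_ * _)%g; apply/conjg_fixP/commgP.
by apply: cA; [apply: normal_commg | apply: normalX].
Qed.

Lemma lncommX_abelian {G : groupType} (A : set G) d (s : seq G) j :
    normal_subgroup A -> abelian_set A -> A d ->
  (lncomm (d ^+ j) s = lncomm d s ^+ j)%g.
Proof.
move=> nA cA; elim: s d => //= z s IHs d Ad.
by rewrite (commXg_abelian _ _ nA) // IHs //; apply: normal_commg.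
Qed.

(** By induction on [j], [[v, z ^+ j]] equals [[v, z] ^+ j] modulo the [l]-th
    term, since [[v, z ^+ j]] lies in the next term and so commutes with [z]
    up to the [l]-th one.  For [j = m] the left side is 1, while
    [[v, z] ^+ m = [v ^+ m, z]]. *)
Lemma ucs_expg {G : groupType} (A M : set G) m l v :
    normal_subgroup A -> abelian_set A -> normal_subgroup M ->
    (forall u z, A u -> commute u (z ^+ m)%g) ->
    A v -> ucs M l.+2 v ->
  ucs M l.+1 (v ^+ m)%g.
Proof.
move=> nA cA nM cAm Av Zv z; have nZ := ucs_normal l nM.
have powE j : exists2 t, ucs M l t & ([~ v, z ^+ j] = [~ v, z] ^+ j * t)%g.
  elim: j => [|j [t Zt vzE]].
    by exists 1%g; [apply: (normal1 nZ) | rewrite commg1 mulg1].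
  exists (t * [~ [~ v, z ^+ j], z])%g.
    by apply: (normalM nZ) => //; apply: Zv.
  rewrite [X in [~ v, X]%g]expgSr commgM expgS -[([~ v, z] * _ * _)%g]mulgA.
  congr (_ * _)%g; rewrite [RHS]mulgA -vzE.
  by rewrite [X in (_ * X)%g]commgEl mulVKg.
have [t Zt] := powE m; rewrite (commXg_abelian _ _ nA) //.
have /commgP/eqP-> := cAm v z Av.
by move/esym/eqP; rewrite mulg_eq1 => /eqP->; apply: (normalV nZ).
Qed.

Lemma ucs1_expg {G : groupType} (A M : set G) m l v :
    normal_subgroup A -> abelian_set A -> normal_subgroup M ->
    (forall u z, A u -> commute u (z ^+ m)%g) ->
    A v -> ucs M l.+1 v ->
  ucs M 1 (v ^+ (m ^ l))%g.
Proof.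
move=> nA cA nM cAm; elim: l v => [|l IHl] v Av Zv //.
rewrite expnS expgnA; apply: IHl; first exact: normalX.
exact: (ucs_expg nA).
Qed.

(** * The centre of the subgroup generated by a normal set *)

Definition centre_products {G : groupType} (Y : seq G) : set G :=
  [set d | products Y d /\ forall u, u \in Y -> commute d u].

Lemma centre_products_normal {G : groupType} (Y : seq G) :
    conj_stable Y -> (forall u, u \in Y -> u^-1%g \in Y) ->
  normal_subgroup (centre_products Y).
Proof.
move=> JY VY; have nN := products_normal JY VY.
split=> [|u v [Nu cu] [Nv cv]|u [Nu cu]|u g [Nu cu]]; split.
- exact: normal1.
- by move=> u _; apply/commute_sym/commute1.
- exact: (normalM nN).
- by move=> w Yw; apply/commute_sym/commuteM; apply/commute_sym; auto.
- exact: (normalV nN).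
- by move=> w Yw; apply/commute_sym/commuteV/commute_sym/cu.
- exact: (normalJ nN).
- move=> w Yw; apply/commgP; rewrite -[w](conjgKV g) -conjRg conjg_eq1.
  by apply/commgP/cu/JY.
Qed.

Lemma centre_products_abelian {G : groupType} (Y : seq G) :
  abelian_set (centre_products Y).
Proof. by move=> u v [_ cu] [Nv _]; apply: products_commute Nv cu. Qed.

(** * Bounds on cardinalities *)

Lemma at_most_card {G : groupType} (H : set G) b :
  at_most H b -> finite_set H /\ H #<= `I_b.
Proof.
move=> [s szs Hs]; have leH : H #<= `I_b.
  apply: (@card_le_trans _ _ _ (nth 1%g s @` `I_b)); last exact: card_image_le.
  apply: subset_card_le => u /Hs su; exists (index u s); last exact: nth_index.
  by rewrite /= (leq_trans _ szs) ?index_mem.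
by split=> //; apply/finite_set_leP; exists b.
Qed.

Lemma card_at_most {G : groupType} (H : set G) b :
  H #<= `I_b -> exists2 s : seq G, size s <= b & H = [set` s].
Proof.
move=> leH; have finH : finite_set H by apply/finite_set_leP; exists b.
exists (finmap.enum_fset (fset_set H)); first exact: geq_card_fset_set.
exact: esym (fset_setK finH).
Qed.

(** * The bound on the lower central term *)

(** Selecting the conjugates inside [X^-1 X], which contains them all when [X]
    is the set of values of long commutators, provides an explicit list and its
    length bound at once. *)
Definition conj_closure {G : groupType} (X : seq G) : seq G :=
  [seq v <- [seq u^-1 * w | u <- X, w <- X]%g |
     `[< exists u z, u \in X /\ v = u ^ z >]%g].

Lemma size_conj_closure {G : groupType} (X : seq G) :
  size (conj_closure X) <= size X * size X.
Proof. by rewrite size_filter (leq_trans (count_size _ _)) ?size_allpairs. Qed.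

Definition lncomm_sets {G : groupType} r k (a : 'I_r -> G) : set G :=
  [set u | exists i, lncomm_set k (a i) u].

Lemma mem_conj_closure {G : groupType} r k (a : 'I_r -> G) (X : seq G) v :
    [set` X] = lncomm_sets k.+1 a ->
  v \in conj_closure X <-> exists u z, lncomm_sets k.+1 a u /\ (v = u ^ z)%g.
Proof.
move=> XE; have inX u : u \in X <-> lncomm_sets k.+1 a u by rewrite -XE.
rewrite mem_filter; split=> [/andP[/asboolP[u [z [/inX Xu ->]]] _]|].
  by exists u, z.
move=> [u [z [Xu ->]]]; apply/andP; split.
  by apply/asboolP; exists u, z; split=> //; apply/inX.
have [i /lncomm_set_conj] := Xu; move/(_ z) => [v' [w [vi wi ->]]].
by apply: allpairs_f; apply/inX; exists i.
Qed.

Lemma lncomm_sets_seq {G : groupType} r k n (a : 'I_r -> G) :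
    (forall i, lncomm_set k (a i) #<= `I_n) ->
  exists2 X : seq G, size X <= r * n & [set` X] = lncomm_sets k a.
Proof.
move=> le_n.
have /choice[F FE] i :
    exists S : seq G, size S <= n /\ lncomm_set k (a i) = [set` S].
  by have [S] := card_at_most (le_n i); exists S.
exists (flatten [seq F i | i <- enum 'I_r]).
  rewrite -[X in X * n](size_enum_ord r); elim: (enum _) => //= i e IHe.
  by rewrite size_cat mulSn leq_add //; case: (FE i).
apply/seteqP; split=> u /=.
  by case/flatten_mapP=> i _ Fiu; exists i; have [_ ->] := FE i.
case=> i; have [_ ->] := FE i => Fiu.
by apply/flatten_mapP; exists i; rewrite ?mem_enum.
Qed.

(** The first factor counts words of length [s * E], with [E = s`! ^ k.+1],
    modulo the subgroup [M] generated by the elements of [Y] killed by [n`!];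
    the second bounds [M]. *)
Lemma lower_central_at_most {G : groupType} r k n (a : 'I_r -> G)
    (X : seq G) s :
    size X * size X <= s -> generated (range a) = [set: G] ->
    [set` X] = lncomm_sets k.+1 a ->
    (forall i, lncomm_set k.+1 (a i) #<= `I_n) ->
  at_most (lower_central G k.+2)
    (s.+1 ^ (s * s`! ^ k.+1) * s.+1 ^ (s * n`!.-1)).
Proof.
move=> leXs gen_a XE le_n; pose Y := conj_closure X.
have inY v : v \in Y <-> exists u z, lncomm_sets k.+1 a u /\ (v = u ^ z)%g.
  exact: mem_conj_closure.
have leYs : size Y <= s := leq_trans (size_conj_closure X) leXs.
clearbody Y; have JY : conj_stable Y.
  move=> _ g /inY[u [z [Xu ->]]]; apply/inY; exists u, (z * g)%g.
  by rewrite conjgM.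
have XY u : lncomm_sets k.+1 a u -> u \in Y.
  by move=> Xu; apply/inY; exists u, 1%g; rewrite conjg1.
have VY u : u \in Y -> u^-1%g \in Y.
  move=> /inY[v [z [[i /lncomm_set_inv[w [x [wi vE]]]] ->]]].
  by rewrite -conjVg vE; apply/JY/JY/XY; exists i.
have nN := products_normal JY VY.
pose Y0 := [seq u <- Y | (u ^+ n`! == 1)%g]; pose M := products Y0.
have JY0 : conj_stable Y0.
  move=> u g; rewrite !mem_filter => /andP[/eqP un Yu].
  by rewrite -conjXg un conj1g eqxx JY.
have nM : normal_subgroup M.
  apply: products_normal => // u; rewrite !mem_filter => /andP[/eqP un Yu].
  by rewrite expVgn un invg1 eqxx VY.
have leM : at_most M (s.+1 ^ (s * n`!.-1)).
  apply: torsion_products_at_most; rewrite ?fact_gt0 //.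
    by rewrite (leq_trans _ leYs) // size_filter count_size.
  by move=> u; rewrite mem_filter => /andP[/eqP].
pose A := centre_products Y.
have nA : normal_subgroup A := centre_products_normal JY VY.
have cA : abelian_set A := @centre_products_abelian _ Y.
(* A is in the upper central term modulo M, tested on the generators only *)
have ZA d : A d -> ucs M k.+1 d.
  move=> Ad; apply: (ucs_centralised_by_generators gen_a nM) => _ [i _ <-].
  have Aad : A [~ a i, d]%g.
    by rewrite -invgR; apply: (normalV nA); apply: normal_commg.
  apply: ucs_lncomm => t szt; apply: products_mem; rewrite mem_filter.
  have Xid j : lncomm_set k.+1 (a i) (lncomm [~ a i, d]%g t ^+ j)%g.
    (* every power of a value at d is a value, at d ^+ j: at most n powers *)
    apply/lncomm_setP; exists ((d ^+ j)%g :: t); rewrite /= ?szt //.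
    rewrite -(lncommX_abelian _ _ nA) //; congr (lncomm _ t).
    by rewrite -!(invgR _ (a i)) (commXg_abelian _ _ nA) // expVgn.
  have [S leSn SE] := card_at_most (le_n i).
  rewrite (expg_fact leSn) ?eqxx => [|j]; last by have := Xid j; rewrite SE.
  by apply: XY; exists i; have := Xid 1; rewrite expg1.
have cAs u z : A u -> commute u (z ^+ s`!)%g.
  move=> [Nu _]; apply/commute_sym/(products_commute Nu) => v Yv.
  by apply: commute_sym; exact: commute_expg_fact JY leYs _.
have Xcentral c x : lncomm_sets k.+1 a c -> M [~ c ^+ (s`! ^ k.+1), x]%g.
  move=> Xc; have Acs : A (c ^+ s`!)%g.
    split=> [|v Yv]; first by apply: normalX => //; apply/products_mem/XY.
    by apply: commute_sym; exact: commute_expg_fact JY leYs _.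
  rewrite expnS expgnA; apply: (ucs1_expg nA cA nM cAs) => //.
  exact: ZA.
have leN : at_most (products Y) (s.+1 ^ (s * s`! ^ k.+1) * s.+1 ^ (s * n`!.-1)).
  apply: (products_at_most (e := (s`! ^ k.+1).+1) JY leYs nM leM).
  move=> _ /inY[c [z [Xc ->]]].
  have [i /lncomm_set_mulJ[x ccxi]] := Xc.
  have: 0 < s`! ^ k.+1 by rewrite expn_gt0 fact_gt0.
  have := Xcentral c x Xc; case: (s`! ^ k.+1) => // E Mt _.
  (* c^(E+2) = (c c^x) (c^x)^E [c^(E+1), x]^-1, conjugated by z *)
  exists (((c * c ^ x) ^ z)%g :: nseq E ((c ^ x) ^ z)%g).
  exists ([~ c ^+ E.+1, x]^-1 ^ z)%g.
  split=> [v|||].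
  - rewrite inE => /predU1P[->|/nseqP[-> _]]; last exact/JY/JY/XY.
    by apply/JY/XY; exists i.
  - by rewrite /= size_nseq.
  - exact/(normalJ nM)/(normalV nM).
  rewrite big_cons prod_nseq -!conjXg -!conjMg; congr (_ ^ z)%g.
  rewrite -(mulgA c) -conjMg -expgS invgR commgEr conjVg.
  by rewrite -mulgA mulVKg -expgS.
have [W leW NW] := leN; exists W => //; apply: subset_trans NW.
apply: (lower_central_ucs nN); have nZ := ucs_normal k.+1 nN.
apply: (generated_ind gen_a (normal1 nZ) (normalM nZ) (normalV nZ)).
move=> _ [i _ <-]; apply: ucs_lncomm => t szt; apply/products_mem/XY.
by exists i; apply/lncomm_setP; exists t.
Qed.

Theorem theorem1p4 :
  exists f : nat -> nat -> nat -> nat,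
    (forall k n r : nat, 0 < k -> 0 < n -> 0 < r -> 0 < f k n r) /\
    (forall (k n r : nat), 0 < k -> 0 < n -> 0 < r ->
     forall (G : groupType) (a : 'I_r -> G),
       generated (range a) = [set: G] ->
       (forall i : 'I_r, lncomm_set k (a i) #<= `I_n) ->
       finite_set (lower_central G k.+1) /\
       lower_central G k.+1 #<= `I_(f k n r)).
Proof.
exists (fun k n r => let s := r * n * (r * n) in
  s.+1 ^ (s * s`! ^ k) * s.+1 ^ (s * n`!.-1)); split.
  by move=> k n r _ _ _; rewrite muln_gt0 !expn_gt0.
move=> [//|k] n r _ _ _ G a gen_a le_n; apply: at_most_card.
have [X szX XE] := lncomm_sets_seq le_n.
exact: (lower_central_at_most (leq_mul szX szX) gen_a XE le_n).
Qed.
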